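(* Let $R$ be a Markov measure on the path space $\Omega$. (a) Let $0\le t\le1$ and let $\alpha,\beta:\Omega\to[0,\infty)$ be such that $\alpha$ is $\mathcal{A}_{[0,t]}$-measurable and $\beta$ is $\mathcal{A}_{[t,1]}$-measurable. Then, for any $\omega$ outside an $R$-negligible set: (i) if $E_R(\alpha\beta\mid X_t)(\omega)=0$, then $E_R(\alpha\mid X_t)(\omega)=0$ or $E_R(\beta\mid X_t)(\omega)=0$; (ii) if $E_R(\alpha\beta\mid X_t)(\omega)>0$, then $E_R(\alpha\mid X_t)(\omega)>0$, $E_R(\beta\mid X_t)(\omega)>0$ and $$E_R(\alpha\beta\mid X_t)(\omega)=E_R(\alpha\mid X_t)(\omega)\,E_R(\beta\mid X_t)(\omega)\in(0,\infty].$$ (b) Let $P$ be a conditionable path measure on $\Omega$ such that $P\prec R$ and whose density writes as $\frac{dP}{dR}=\alpha\beta$ with $\alpha,\beta:\Omega\to[0,\infty)$ such that $\alpha$ is $\mathcal{A}_{[0,t]}$-measurable and $\beta$ is $\mathcal{A}_{[t,1]}$-measurable, for some $0\le t\le1$. Then, $P$-a.e., $$E_R(\alpha\mid X_t),\,E_R(\beta\mid X_t)\in(0,\infty)\quad\text{and}\quad E_R(\alpha\beta\mid X_t)=E_R(\alpha\mid X_t)\,E_R(\beta\mid X_t)\in(0,\infty).$$ Furthermore, $R$-a.e., $$E_R(\alpha\beta\mid X_t)=\mathbf{1}_{\{E_R(\alpha\mid X_t)<\infty,\ E_R(\beta\mid X_t)<\infty\}}\,E_R(\alpha\mid X_t)\,E_R(\beta\mid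 X_t)\in[0,\infty).$$
   Context: $\mathcal{X}$ is a Polish space with its Borel $\sigma$-field, and $\Omega$ is the path space $D([0,1],\mathcal{X})$ of càdlàg paths (or $C([0,1],\mathcal{X})$, continuous paths), with the $\sigma$-field generated by the canonical process $X_t(\omega)=\omega_t$, $0\le t\le1$. For $\mathcal{T}\subset[0,1]$, $X_{\mathcal{T}}:=(X_t)_{t\in\mathcal{T}}$, and $\mathcal{A}_{[s,t]}$ denotes the $\sigma$-field on $\Omega$ generated by $X_{[s,t]}$. A path measure is any positive, possibly unbounded, measure $Q$ on $\Omega$; $Q_t:=(X_t)_{\#}Q$. It is conditionable if $Q_t$ is a $\sigma$-finite measure on $\mathcal{X}$ for every $t\in[0,1]$. For a conditionable $Q$ and any nonempty $\mathcal{T}\subset[0,1]$, $Q$ restricted to $\sigma(X_{\mathcal{T}})$ is $\sigma$-finite, and for $f\in L^1(Q)$, $E_Q(f\mid X_{\mathcal{T}})$ is the $Q$-a.e. unique $\sigma(X_{\mathcal{T}})$-measurable integrable function such that $\int hf\,dQ=\int hE_Q(f\mid X_{\mathcal{T}})\,dQ$ for all bounded $\sigma(X_{\mathcal{T}})$-measurable $h$; it extends to any nonnegative measurable $f$ by monotone limits, with values in $[0,\infty]$ (equivalently, as the integral of $f$ against the conditional probability $Q(\cdot\mid X_{\mathcal{T}})$), so that $\int af\,dQ=\int aE_Q(f\mid X_{\mathcal{T}})\,dQ$ for every nonnegative $\sigma(X_{\mathcal{T}})$-measurable $a$. $Q$ is Markov if it is conditionable and for all $0\le t\le1$, $Q(X_{[t,1]}\in\cdot\mid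 X_{[0,t]})=Q(X_{[t,1]}\in\cdot\mid X_t)$. $P\prec R$ means that there is a measurable $\theta:\Omega\to[0,\infty)$ with $\int f\,dP=\int f\theta\,dR\in[0,\infty]$ for all measurable $f\ge0$; then $dP/dR:=\theta$. In products with an indicator function, $0\cdot\infty=0$. *)

(* Defs.v *)
From HB Require Import structures.
From mathcomp Require Import all_boot all_order all_algebra.
From mathcomp Require Import all_classical all_reals all_analysis.
From mathcomp Require Import measurable_realfun.
Set Implicit Arguments.
Unset Strict Implicit.
Unset Printing Implicit Defensive.
Import Order.TTheory GRing.Theory Num.Theory.
Import numFieldNormedType.Exports.

Local Open Scope classical_set_scope.
Local Open Scope ring_scope.
Local Open Scope ereal_scope.

(* Separable, and completely metrizable by some real-valued distance. *)
Definition polish (R : realType) (X : topologicalType) : Prop :=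
  (exists2 D : set X, countable D & dense D) /\
  exists d : X -> X -> R,
    [/\ forall x y, d x y = 0%R <-> x = y,
        forall x y, d x y = d y x,
        forall x y z, (d x z <= d x y + d y z)%R,
        forall (x : X) (A : set X), nbhs x A <->
          exists2 e : R, (0 < e)%R & [set y | (d x y < e)%R] `<=` A
      & forall u : nat -> X,
          (forall e : R, (0 < e)%R ->
             \forall m & n \near \oo, (d (u m) (u n) < e)%R) ->
          exists l : X, u @ \oo --> l].

(* Used as a type through the coercion from sets to types, with its subspace
   topology. *)
Definition unit_itv (R : realType) : set R := `[0%R, 1%R]%classic.
Arguments unit_itv : clear implicits.

(* The one-sided filters are improper on the right of 1 and on the left of 0,
   so nothing is required there. *)
Definition cadlag (R : realType) (X : topologicalType)
    (w : unit_itv R -> X) : Prop :=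
  forall t : unit_itv R,
    (w @ within [set s : unit_itv R | (\val t < \val s)%R] (nbhs t) --> w t) /\
    exists l : X,
      w @ within [set s : unit_itv R | (\val s < \val t)%R] (nbhs t) --> l.

(* The two admissible path spaces: D([0,1], X) and C([0,1], X). *)
Variant path_kind := Cadlag | Continuous.

Definition is_path (R : realType) (X : topologicalType) (k : path_kind)
    (w : unit_itv R -> X) : Prop :=
  match k with
  | Cadlag => cadlag w
  | Continuous => continuous w
  end.

Record path_space (R : realType) (X : topologicalType) (k : path_kind) :=
  Path { path_fun :> unit_itv R -> X ; path_funP : is_path k path_fun }.

Lemma is_path_cst (R : realType) (X : topologicalType) (k : path_kind) (x : X) :
  is_path k (fun _ : unit_itv R => x).
Proof.
case: k => [t|t]; last by apply: cst_continuous.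
by split; [|exists x]; apply: cvg_cst.
Qed.

HB.instance Definition _ (R : realType) (X : topologicalType) k :=
  gen_eqMixin (@path_space R X k).
HB.instance Definition _ (R : realType) (X : topologicalType) k :=
  gen_choiceMixin (@path_space R X k).
HB.instance Definition _ (R : realType) (X : ptopologicalType) k :=
  isPointed.Build (@path_space R X k) (Path (is_path_cst R k (point : X))).

Definition borel_space (X : ptopologicalType) := g_sigma_algebraType (@open X).

Definition canonical_process (R : realType) (X : topologicalType) (k : path_kind)
  (t : unit_itv R) (w : path_space R X k) : X := w t.

(* The events {X_t \in B}, t in T and B Borel; they generate sigma(X_T). *)
Definition coord_events (R : realType) (X : topologicalType) (k : path_kind)
    (T : set (unit_itv R)) : set (set (path_space R X k)) :=
  \bigcup_(t in T) preimage_set_system setT (@canonical_process R X k t) <<s @open X >>.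

Definition Omega (R : realType) (X : ptopologicalType) (k : path_kind) :=
  g_sigma_algebraType (@coord_events R X k setT).

(* Measurability with respect to sigma(X_T). *)
Definition measurable_at (R : realType) (X : ptopologicalType) (k : path_kind)
    (T : set (unit_itv R)) d (Y : measurableType d) (f : Omega R X k -> Y) :=
  measurable_fun setT (f : g_sigma_algebraType (@coord_events R X k T) -> Y).

(* [a, b] as a set of times, so that sigma(X_(time_itv a b)) is A_[a,b]. *)
Definition time_itv (R : realType) (a b : R) : set (unit_itv R) :=
  [set s | (a <= \val s <= b)%R].

Section path_measures.
Variables (R : realType) (X : ptopologicalType) (k : path_kind).
Local Notation Omega := (Omega R X k).
Implicit Types (P Q : {measure set Omega -> \bar R}) (T : set (unit_itv R)).

Definition conditionable Q : Prop :=
  forall t : unit_itv R,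
    sigma_finite setT (pushforward Q (@canonical_process R X k t : Omega -> borel_space X)).

(* g is a version of E_Q(f | X_T), f in L^1(Q). *)
Definition cond_exp_L1 Q T (f g : Omega -> \bar R) : Prop :=
  [/\ measurable_at T g,
      Q.-integrable setT g
    & forall h : Omega -> R, measurable_at T h ->
        (exists M : R, forall w, (`|h w| <= M)%R) ->
        \int[Q]_w ((h w)%:E * f w) = \int[Q]_w ((h w)%:E * g w)].

(* g is a version of E_Q(f | X_T), f nonnegative measurable: the limit of the
   conditional expectations of integrable functions that increase to f. *)
Definition cond_exp Q T (f g : Omega -> \bar R) : Prop :=
  [/\ measurable_at T g,
      forall w, 0 <= g w
    & exists f_ g_ : nat -> Omega -> \bar R,
      [/\ forall n, Q.-integrable setT (f_ n) /\ forall w, 0 <= f_ n w,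
          forall w, {homo f_^~ w : m n / (m <= n)%N >-> m <= n},
          forall w, f_ n w @[n --> \oo] --> f w,
          forall n, cond_exp_L1 Q T (f_ n) (g_ n)
        & {ae Q, forall w, g_ n w @[n --> \oo] --> g w}]].

(* For every event B of A_[t,1], Q(B | X_[0,t]) = Q(B | X_t), Q-a.e. *)
Definition markov_measure Q : Prop :=
  conditionable Q /\
  forall (t : unit_itv R) (B : set Omega),
    <<s coord_events (time_itv (\val t) 1) >> B ->
    exists g h : Omega -> \bar R,
      [/\ cond_exp Q (time_itv 0 (\val t)) (fun w => (\1_B w)%:E) g,
          cond_exp Q [set t] (fun w => (\1_B w)%:E) h
        & {ae Q, forall w, g w = h w}].

(* P is absolutely continuous with respect to Q and dP/dQ = theta. *)
Definition is_density P Q (theta : Omega -> R) : Prop :=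
  [/\ measurable_fun setT theta,
      forall w, (0 <= theta w)%R
    & forall f : Omega -> \bar R, measurable_fun setT f ->
        (forall w, 0 <= f w) ->
        \int[P]_w f w = \int[Q]_w (f w * (theta w)%:E)].

End path_measures.

(* Main.v *)
Require Import Defs.
From mathcomp Require Import all_boot all_order all_algebra.
From mathcomp Require Import all_classical all_reals all_analysis.
From mathcomp Require Import measurable_realfun.
Import Order.TTheory GRing.Theory Num.Theory.
Import numFieldNormedType.Exports.
Import HBNNSimple.
Set Implicit Arguments.
Unset Strict Implicit.
Unset Printing Implicit Defensive.
Local Open Scope classical_set_scope.
Local Open Scope ring_scope.
Local Open Scope ereal_scope.

(** Everything reduces to one identity: for a Markov measure [Q],
    [E_Q(alpha beta | X_t) = E_Q(alpha | X_t) * E_Q(beta | X_t)] holds [Q]-a.e.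
    in [[0, +oo]] with [0 * +oo = 0] ([cond_expM]).

    A version [g] of [E_Q(f | X_T)] satisfies
    [\int a f dQ = \int a g dQ] for every nonnegative, possibly infinite,
    [sigma(X_T)]-measurable [a] ([cond_expE]).  Now let [c >= 0] be a function
    of [X_t] and let [B] be an event of the future.  The Markov property
    replaces [1_B] by [h = E_Q(1_B | X_t)] against the past function
    [c alpha]; then [alpha] can be conditioned because [c h] depends on [X_t]
    only, and [h] is turned back into [1_B] against [c E_Q(alpha | X_t)]:

      [\int 1_B c alpha = \int h c alpha = \int h c E_Q(alpha | X_t)
                          = \int 1_B c E_Q(alpha | X_t)].

    So the measures [c alpha Q] and [c E_Q(alpha | X_t) Q] agree on the future
    ([integral_past_future]).  Integrating [beta] against both, and then
    conditioning [beta], gives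
    [\int c alpha beta = \int c E_Q(alpha | X_t) E_Q(beta | X_t)].
    The left side is also [\int c E_Q(alpha beta | X_t)], and since [Q] is
    sigma-finite on [sigma(X_t)] the two integrands are a.e. equal
    ([ae_eq_measurable_at]).

    Part (a) reads off the zeros and the positivity of a product in
    [[0, +oo]].  For part (b), [P = theta Q] with [theta = alpha beta] gives
    [P(A) = \int_A E_Q(theta | X_t) dQ] for every event [A] of [sigma(X_t)].
    Hence [P] does not charge [{E_Q(theta | X_t) = 0}], and covering [Omega]
    by events of [sigma(X_t)] of finite [P]-measure, which exist because [P]
    is conditionable, shows that [E_Q(theta | X_t)] is [Q]-a.e. finite.  A
    product that is positive and finite has positive and finite factors; where
    a factor is infinite and the product is finite, the product is zero. *)

(** * Nonnegative integrals tested on a sub-sigma-algebra *)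

Section integrals.
Context d (T : measurableType d) (R : realType).
Variable mu : {measure set T -> \bar R}.
Implicit Types f g : T -> \bar R.

Lemma integral_indicE (A : set T) f :
  \int[mu]_(x in A) f x = \int[mu]_x ((\1_A x)%:E * f x).
Proof.
rewrite integral_mkcond; apply: eq_integral => x _.
by rewrite epatch_indic muleC.
Qed.

(** The integral of [g - f] over [A] is nonpositive, so [g - f] vanishes a.e.
    on [A], where it is positive. *)
Lemma measure0_of_lt_integral (A : set T) f g : measurable A ->
  mu.-integrable A f -> mu.-integrable A g ->
  (forall x, A x -> f x < g x) ->
  \int[mu]_(x in A) g x <= \int[mu]_(x in A) f x -> mu A = 0.
Proof.
move=> mA fi gi fg gf.
have mgf : measurable_fun A (fun x => g x - f x).
  by apply: emeasurable_funB; [exact: (measurable_int _ gi)|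
                               exact: (measurable_int _ fi)].
have gf0 x : A x -> 0 < g x - f x by move=> Ax; rewrite sube_gt0 fg.
have I0 : \int[mu]_(x in A) `|g x - f x| = 0.
  transitivity (\int[mu]_(x in A) (g x - f x)).
    apply: eq_integral => x; rewrite inE => Ax.
    by rewrite gee0_abs// ltW// gf0.
  apply/eqP; rewrite eq_le integral_ge0 ?andbT; last first.
    by move=> x Ax; rewrite ltW// gf0.
  by rewrite integralB// leeBlDr ?add0e// integrable_fin_num.
have [N [mN N0 sub]] := (ae_eq_integral_abs mu mA mgf).1 I0.
apply: (subset_measure0 mA mN) => // x Ax; apply: sub => /= /(_ Ax) E.
by have := gf0 x Ax; rewrite E ltxx.
Qed.

End integrals.

(** A sub-sigma-algebra is presented as the preimages under a measurable map
    [phi]; below, [phi] is the identity of [Omega] into the same set with fewer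
    measurable sets. *)
Section pullback.
Context d (T : measurableType d) d' (S : measurableType d') (R : realType).
Variables (mu : {measure set T -> \bar R}) (phi : T -> S).
Hypothesis mphi : measurable_fun setT phi.
Implicit Types f g : T -> \bar R.

Lemma cvg_integral_approx f (b : S -> \bar R) (mb : measurable_fun setT b) :
  measurable_fun setT f -> (forall x, 0 <= f x) -> (forall y, 0 <= b y) ->
  \int[mu]_x ((nnsfun_approx measurableT mb n (phi x))%:E * f x) @[n --> \oo]
    --> \int[mu]_x (b (phi x) * f x).
Proof.
move=> mf f0 b0.
set s := nnsfun_approx measurableT mb.
have s_cvg y : (s n y)%:E @[n --> \oo] --> b y.
  by apply: (cvg_nnsfun_approx measurableT mb (fun y _ => b0 y)).
have s_nd y : {homo (fun n => (s n y)%:E) : n m / (n <= m)%N >-> n <= m}.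
  move=> n m nm; rewrite lee_fin.
  by have /lefP := nd_nnsfun_approx measurableT mb nm; exact.
have s_le n y : (s n y)%:E <= b y.
  rewrite (cvg_unique _ (s_cvg y) (ereal_nondecreasing_cvgn (s_nd y)))//.
  by apply: ereal_sup_ubound; exists n.
have -> : \int[mu]_x (b (phi x) * f x) =
    \int[mu]_x limn (fun n => (s n (phi x))%:E * f x).
  apply: eq_integral => x _; apply/esym/cvg_lim => //.
  (* Multiplication is discontinuous at (0, +oo), so the two vanishing cases
     are separated; there the products are constantly zero. *)
  have [fx0|fx0] := eqVneq (f x) 0.
    by rewrite fx0 mule0; under eq_fun do rewrite mule0; exact: cvg_cst.
  have [bx0|bx0] := eqVneq (b (phi x)) 0.
    rewrite bx0 mul0e; apply: cvg_near_cst; apply: nearW => n.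
    suff -> : (s n (phi x))%:E = 0 by rewrite mul0e.
    have := s_le n (phi x); rewrite bx0 => sx0.
    by apply/eqP; rewrite eq_le sx0 lee_fin fun_ge0.
  apply: cvgeM => //; last exact: cvg_cst.
  by rewrite mule_defE (negbTE bx0) (negbTE fx0).
apply: cvg_monotone_convergence => //.
- move=> n; apply: emeasurable_funM => //.
  by apply/measurable_EFinP; apply: measurableT_comp.
- by move=> n x _; rewrite mule_ge0// lee_fin.
- by move=> x _ n m nm; rewrite lee_wpmul2r// s_nd.
Qed.

Lemma integral_nnsfunM f (s : {nnsfun S >-> R}) :
  measurable_fun setT f -> (forall x, 0 <= f x) ->
  \int[mu]_x ((s (phi x))%:E * f x) =
  (\sum_(y \in range s)
     (y%:E * \int[mu]_x ((\1_(s @^-1` [set y]) (phi x))%:E * f x)%E)%E)%R.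
Proof.
move=> mf f0.
have ge0 y x : 0 <= y%:E * ((\1_(s @^-1` [set y]) (phi x))%:E * f x).
  by rewrite muleA mule_ge0// nnfun_muleindic_ge0.
have mI y : measurable_fun setT
    (fun x => (\1_(s @^-1` [set y]) (phi x))%:E * f x).
  apply: emeasurable_funM => //; apply/measurable_EFinP.
  by apply: (measurableT_comp (f := \1_(s @^-1` [set y]) : S -> R) _ mphi);
    exact: measurable_indic.
transitivity (\int[mu]_x (\sum_(y \in range s)
    (y%:E * ((\1_(s @^-1` [set y]) (phi x))%:E * f x))%E)%R).
  apply: eq_integral => x _; rewrite (fimfunE s) -fsumEFin//.
  rewrite ge0_mule_fsuml; last by move=> y; exact: nnfun_muleindic_ge0.
  by apply: eq_fsbigr => y _; rewrite muleA.
rewrite ge0_integral_fsum//; last by move=> y; apply: emeasurable_funM.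
apply: eq_fsbigr => y /[!inE] -[z _ <-]; rewrite ge0_integralZl//.
- by move=> x _; rewrite mule_ge0.
- by rewrite lee_fin.
Qed.

(** The measures [f mu] and [g mu] agree on the sigma-algebra of [phi], so they
    integrate its nonnegative functions equally.  As they may fail to be
    sigma-finite, this is proved on simple functions and extended by monotone
    convergence. *)
Lemma eq_integral_pullback f g (b : S -> \bar R) :
  measurable_fun setT f -> (forall x, 0 <= f x) ->
  measurable_fun setT g -> (forall x, 0 <= g x) ->
  measurable_fun setT b -> (forall y, 0 <= b y) ->
  (forall B, measurable B ->
     \int[mu]_x ((\1_B (phi x))%:E * f x) =
     \int[mu]_x ((\1_B (phi x))%:E * g x)) ->
  \int[mu]_x (b (phi x) * f x) = \int[mu]_x (b (phi x) * g x).
Proof.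
move=> mf f0 mg g0 mb b0 fg.
have cf := cvg_integral_approx mb mf f0 b0.
have cg := cvg_integral_approx mb mg g0 b0.
set s := nnsfun_approx measurableT mb in cf cg.
suff E : (fun n => \int[mu]_x ((s n (phi x))%:E * f x)) =
         (fun n => \int[mu]_x ((s n (phi x))%:E * g x)).
  by rewrite E in cf; exact: (cvg_unique _ cf cg).
apply/funext => n; rewrite !integral_nnsfunM//.
by apply: eq_fsbigr => y _; rewrite fg.
Qed.

(** On the part of [C n] where [v <= m], both functions have finite integrals,
    so [v < u] holds at most on a null set there.  These parts cover [{v < u}],
    as [v] is finite on it. *)
Lemma ae_le_pullback (C : (set S)^nat) (u v : S -> \bar R) :
  (forall n, measurable (C n)) -> (forall n, mu (phi @^-1` C n) < +oo) ->
  \bigcup_n C n = setT ->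
  measurable_fun setT u -> (forall y, 0 <= u y) ->
  measurable_fun setT v -> (forall y, 0 <= v y) ->
  (forall B, measurable B ->
     \int[mu]_x ((\1_B (phi x))%:E * u (phi x)) <=
     \int[mu]_x ((\1_B (phi x))%:E * v (phi x))) ->
  {ae mu, forall x, u (phi x) <= v (phi x)}.
Proof.
move=> mC Coo CT mu_ u0 mv v0 uv.
pose A n m := C n `&` ([set y | v y <= m%:R%:E] `&` [set y | v y < u y]).
have mA n m : measurable (A n m).
  apply: measurableI => //; apply: measurableI.
    by rewrite -[X in measurable X]setTI; exact: emeasurable_fun_infty_c.
  by rewrite -[X in measurable X]setTI; exact: measurable_lte.
have mphiA n m : measurable (phi @^-1` A n m).
  by rewrite -[X in measurable X]setTI; exact: mphi.
have muA n m : mu (phi @^-1` A n m) = 0.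
  have muAoo : mu (phi @^-1` A n m) < +oo.
    apply: le_lt_trans (Coo n); rewrite le_measure ?inE//.
      by rewrite -[X in measurable X]setTI; exact: mphi.
    by move=> x [].
  have mw (w : S -> \bar R) : measurable_fun setT w ->
      measurable_fun (phi @^-1` A n m) (w \o phi).
    by move=> mw; apply: measurable_funTS; exact: measurableT_comp.
  have vi : mu.-integrable (phi @^-1` A n m) (v \o phi).
    apply/integrableP; split; first exact: mw.
    apply: (@le_lt_trans _ _ (m%:R%:E * mu (phi @^-1` A n m))).
      apply: integral_le_bound => //; first exact: mw.
      by apply: aeW => x [_ [/= vm _]]; rewrite gee0_abs.
    by rewrite lte_mul_pinfty// lee_fin.
  have le : \int[mu]_(x in phi @^-1` A n m) u (phi x) <=
            \int[mu]_(x in phi @^-1` A n m) v (phi x).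
    by rewrite [leLHS]integral_indicE [leRHS]integral_indicE; exact: uv.
  have ui : mu.-integrable (phi @^-1` A n m) (u \o phi).
    apply/integrableP; split; first exact: mw.
    under eq_integral do rewrite gee0_abs//=.
    by apply: le_lt_trans le _; exact: (integrable_lty _ vi).
  by apply: measure0_of_lt_integral vi ui _ le => // x [_ []].
have neg : mu.-negligible (\bigcup_n \bigcup_m phi @^-1` A n m).
  apply: negligible_bigcup => n; apply: negligible_bigcup => m.
  by exists (phi @^-1` A n m); split.
apply: negligibleS neg => x /= /negP; rewrite -ltNge => vu.
have [n _ Cx] : (\bigcup_n C n) (phi x) by rewrite CT.
have vfin : v (phi x) \is a fin_num.
  by rewrite ge0_fin_numE// (lt_le_trans vu)// leey.
exists n => //; exists (Num.bound (fine (v (phi x)))) => //; split => //.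
split => //=; rewrite -(fineK vfin) lee_fin ltW// archi_boundP//.
exact: fine_ge0.
Qed.
End pullback.

(** * The sigma-algebras generated by parts of the path *)

Section sub_sigma_algebras.
Context (R : realType) (X : ptopologicalType) (k : path_kind).
Implicit Types T : set (unit_itv R).

Lemma measurable_at_idfun T T' : T `<=` T' ->
  measurable_fun setT (idfun : g_sigma_algebraType (@coord_events R X k T') ->
                               g_sigma_algebraType (@coord_events R X k T)).
Proof.
move=> TT' _ B mB; rewrite setTI.
by apply: sub_sigma_algebra2 mB => A [t Tt tA]; exists t => //; exact: TT'.
Qed.

Lemma sub_measurable_at T T' d (Y : measurableType d) (f : Omega R X k -> Y) :
  T `<=` T' -> measurable_at T f -> measurable_at T' f.
Proof.
move=> TT' mf; exact: (measurableT_comp mf (measurable_at_idfun TT')).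
Qed.

Lemma measurable_idfun_at T :
  measurable_fun setT (idfun : Omega R X k ->
                               g_sigma_algebraType (@coord_events R X k T)).
Proof. exact: measurable_at_idfun. Qed.

Lemma measurable_at_set T (A : set (Omega R X k)) :
  <<s coord_events T >> A -> measurable A.
Proof. by move=> /(measurable_idfun_at measurableT); rewrite setTI. Qed.

Lemma measurable_at_fun T d (Y : measurableType d) (f : Omega R X k -> Y) :
  measurable_at T f -> measurable_fun setT f.
Proof. exact: sub_measurable_at. Qed.

Lemma measurable_atM T (f g : Omega R X k -> \bar R) :
  measurable_at T f -> measurable_at T g ->
  measurable_at T (fun w => f w * g w).
Proof. by move=> mf mg; exact: emeasurable_funM. Qed.

End sub_sigma_algebras.

(** * Conditional expectation tested against nonnegative functions *)

Section conditional_expectations.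
Context (R : realType) (X : ptopologicalType) (k : path_kind).
Variables (Q : {measure set Omega R X k -> \bar R}) (T : set (unit_itv R)).
Implicit Types f g : Omega R X k -> \bar R.

Lemma cond_exp_L1_indic f g (A : set (Omega R X k)) :
  cond_exp_L1 Q T f g -> <<s coord_events T >> A ->
  \int[Q]_w ((\1_A w)%:E * f w) = \int[Q]_w ((\1_A w)%:E * g w).
Proof.
move=> [_ _ fg] mA; apply: fg.
  exact: (measurable_indic (T := g_sigma_algebraType (coord_events T))).
exists 1%R => w; rewrite indicE.
by case: (_ \in _); rewrite ?normr0 ?normr1.
Qed.

(** Tested on the event [{g2 < g1}], which belongs to the conditioning
    sigma-algebra, the conditional expectations have the integrals of [f1] and
    [f2], in the wrong order unless the event is null. *)
Lemma cond_exp_L1_le f1 f2 g1 g2 :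
  cond_exp_L1 Q T f1 g1 -> cond_exp_L1 Q T f2 g2 ->
  measurable_fun setT f1 -> measurable_fun setT f2 ->
  (forall w, 0 <= f1 w) -> (forall w, f1 w <= f2 w) ->
  {ae Q, forall w, g1 w <= g2 w}.
Proof.
move=> fg1 fg2 mf1 mf2 f10 f12.
have [mg1 ig1 _] := fg1; have [mg2 ig2 _] := fg2.
pose A := [set w | g2 w < g1 w].
have mA : <<s coord_events T >> A.
  rewrite /A -[X in <<s _ >> X]setTI.
  exact: (measurable_lte (T := g_sigma_algebraType (coord_events T))).
have mA' : measurable A := measurable_at_set mA.
have m1 : measurable_fun setT (fun w => (\1_A w)%:E : \bar R).
  by apply/measurable_EFinP; exact: measurable_indic.
exists A; split => //; last by move=> w /= /negP; rewrite -ltNge.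
apply: (measure0_of_lt_integral mA' (integrableS _ _ _ ig2)
                                    (integrableS _ _ _ ig1)) => //.
rewrite [leLHS]integral_indicE [leRHS]integral_indicE.
rewrite -(cond_exp_L1_indic fg1 mA) -(cond_exp_L1_indic fg2 mA).
apply: ge0_le_integral => //.
- by move=> w _; rewrite mule_ge0// lee_fin.
- exact: emeasurable_funM.
- exact: emeasurable_funM.
- by move=> w _; rewrite lee_wpmul2l// lee_fin.
Qed.

Lemma cond_exp_L1_cst0 : cond_exp_L1 Q T (cst 0) (cst 0).
Proof.
split => //; first exact: (measurable_cst (T1 := g_sigma_algebraType (coord_events T))).
exact: integrable0.
Qed.

(** The versions [g_ n] increase and are nonnegative only almost everywhere;
    monotone convergence is applied off a null set [N] containing all the
    exceptional points. *)
Lemma cond_exp_indic f g (A : set (Omega R X k)) :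
  cond_exp Q T f g -> <<s coord_events T >> A ->
  \int[Q]_w ((\1_A w)%:E * f w) = \int[Q]_w ((\1_A w)%:E * g w).
Proof.
move=> [mg g0 [f_ [g_ [f_i f_nd f_cvg fg_ g_cvg]]]] mA.
have mf_ n : measurable_fun setT (f_ n) by apply: (measurable_int _ (f_i n).1).
have mg_ n : measurable_fun setT (g_ n).
  by have [] := fg_ n => /measurable_at_fun.
have mA' : measurable A := measurable_at_set mA.
have m1 : measurable_fun setT (fun w => (\1_A w)%:E : \bar R).
  by apply/measurable_EFinP; exact: measurable_indic.
have ae_g : {ae Q, forall w, (forall n, 0 <= g_ n w <= g_ n.+1 w) /\
    (g_ n w @[n --> \oo] --> g w)}.
  have ge0 n : {ae Q, forall w, 0 <= g_ n w}.
    by apply: (cond_exp_L1_le cond_exp_L1_cst0 (fg_ n)) => // w; exact: (f_i n).2.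
  have nd n : {ae Q, forall w, g_ n w <= g_ n.+1 w}.
    apply: (cond_exp_L1_le (fg_ n) (fg_ n.+1)) => // [w|w].
      exact: (f_i n).2.
    exact: f_nd.
  apply: filterS3 (ae_foralln ge0) (ae_foralln nd) g_cvg => w h1 h2 h3.
  by split => // n; rewrite h1 h2.
have [N [mN N0 subN]] := ae_g.
have okN w : (~` N) w ->
    (forall n, 0 <= g_ n w <= g_ n.+1 w) /\ (g_ n w @[n --> \oo] --> g w).
  by move=> Nw; apply: contrapT => h; exact/Nw/subN.
have aeN (u : Omega R X k -> \bar R) : measurable_fun setT u ->
    \int[Q]_w ((\1_A w)%:E * u w) =
    \int[Q]_w ((\1_(A `&` ~` N) w)%:E * u w).
  move=> mu; apply: ae_eq_integral => //.
  - exact: emeasurable_funM.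
  - apply: emeasurable_funM => //; apply/measurable_EFinP.
    by apply: measurable_indic; apply: measurableI => //; exact: measurableC.
  - exists N; split => // w /= h; apply: contrapT => Nw; apply: h => _.
    by rewrite !indicE in_setI [w \in ~` N]mem_set// andbT.
have mAN : measurable (A `&` ~` N) by apply: measurableI => //; exact: measurableC.
have mg1 : measurable_fun setT g by exact: measurable_at_fun mg.
have mf : measurable_fun setT f.
  by apply: emeasurable_fun_cvg mf_ _ => w _; exact: f_cvg.
rewrite (aeN g)// -[LHS]integral_indicE -[RHS]integral_indicE.
have cg : \int[Q]_(w in A `&` ~` N) g_ n w @[n --> \oo] -->
    \int[Q]_(w in A `&` ~` N) g w.
  rewrite (_ : \int[Q]_(w in A `&` ~` N) g w =
    \int[Q]_(w in A `&` ~` N) limn (g_^~ w)); last first.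
    apply: eq_integral => w; rewrite inE => -[_ /okN[_ gw]].
    by apply/esym/cvg_lim.
  apply: cvg_monotone_convergence => //.
  - by move=> n; exact: measurable_funTS.
  - by move=> n w [_ /okN[/(_ n)/andP[]]].
  - move=> w [_ /okN[h _]]; apply/nondecreasing_seqP => n.
    by have /andP[] := h n.
have cf : \int[Q]_(w in A) f_ n w @[n --> \oo] --> \int[Q]_(w in A) f w.
  rewrite (_ : \int[Q]_(w in A) f w = \int[Q]_(w in A) limn (f_^~ w)); last first.
    by apply: eq_integral => w _; apply/esym/cvg_lim.
  apply: cvg_monotone_convergence => //.
  - by move=> n; exact: measurable_funTS.
  - by move=> n w _; exact: (f_i n).2.
suff E : (fun n => \int[Q]_(w in A) f_ n w) =
    (fun n => \int[Q]_(w in A `&` ~` N) g_ n w).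
  by rewrite E in cf; exact: (cvg_unique _ cf cg).
apply/funext => n; rewrite integral_indicE [RHS]integral_indicE -(aeN (g_ n))//.
exact: cond_exp_L1_indic.
Qed.

(** The characteristic property of the conditional expectation of a
    nonnegative function, with test functions that may be unbounded or even
    infinite; this form is what lets conditional expectations themselves serve
    as test functions. *)
Lemma cond_expE f g (a : Omega R X k -> \bar R) :
  cond_exp Q T f g -> measurable_at T a -> (forall w, 0 <= a w) ->
  \int[Q]_w (a w * f w) = \int[Q]_w (a w * g w).
Proof.
move=> fg ma a0; have [mg g0 [f_ [g_ [f_i f_nd f_cvg _ _]]]] := fg.
apply: (eq_integral_pullback (@measurable_idfun_at R X k T)) => //.
- apply: emeasurable_fun_cvg (fun n => measurable_int _ (f_i n).1) _ => w _.
  exact: f_cvg.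
- move=> w; rewrite -(cvg_lim _ (f_cvg w))//.
  apply: lime_ge; first by apply/cvg_ex; exists (f w); exact: f_cvg.
  by apply: nearW => n; exact: (f_i n).2.
- exact: measurable_at_fun mg.
- by move=> B mB; exact: cond_exp_indic.
Qed.

End conditional_expectations.

(** * Uniqueness of functions of the present *)

Section sigma_finiteness.
Context (R : realType) (X : ptopologicalType) (k : path_kind).
Variables (Q : {measure set Omega R X k -> \bar R}) (t : unit_itv R).

Lemma conditionable_cover : conditionable Q ->
  exists C : (set (Omega R X k))^nat,
    [/\ forall n, <<s coord_events [set t] >> (C n),
        forall n, Q (C n) < +oo & \bigcup_n C n = setT].
Proof.
move=> /(_ t) [F FT Foo].
exists (fun n => @canonical_process R X k t @^-1` F n); split => [n|n|].
- apply: sub_sigma_algebra; exists t => //; exists (F n); last by rewrite setTI.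
  exact: (Foo n).1.
- exact: (Foo n).2.
- by rewrite -preimage_bigcup -FT preimage_setT.
Qed.

Lemma ae_eq_measurable_at (u v : Omega R X k -> \bar R) : conditionable Q ->
  measurable_at [set t] u -> (forall w, 0 <= u w) ->
  measurable_at [set t] v -> (forall w, 0 <= v w) ->
  (forall a : Omega R X k -> \bar R,
     measurable_at [set t] a -> (forall w, 0 <= a w) ->
     \int[Q]_w (a w * u w) = \int[Q]_w (a w * v w)) ->
  {ae Q, forall w, u w = v w}.
Proof.
move=> /conditionable_cover[C [mC Coo CT]] mu u0 mv v0 uv.
have uvB (B : set (g_sigma_algebraType (@coord_events R X k [set t]))) :
    measurable B ->
    \int[Q]_w ((\1_B w)%:E * u w) = \int[Q]_w ((\1_B w)%:E * v w).
  move=> mB; apply: uv => [|w]; last by rewrite lee_fin.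
  rewrite /measurable_at; apply/measurable_EFinP.
  exact: (measurable_indic (T := g_sigma_algebraType (coord_events [set t]))).
have mid := @measurable_idfun_at R X k [set t].
have le1 : {ae Q, forall w, u w <= v w}.
  by apply: (ae_le_pullback mid mC) => // B mB; rewrite uvB.
have le2 : {ae Q, forall w, v w <= u w}.
  by apply: (ae_le_pullback mid mC) => // B mB; rewrite uvB.
by apply: filterS2 le1 le2 => w uw vw; apply/eqP; rewrite eq_le uw vw.
Qed.

End sigma_finiteness.

(** * Past and future are conditionally independent given the present *)

Section markov.
Context (R : realType) (X : ptopologicalType) (k : path_kind).
Variable Q : {measure set Omega R X k -> \bar R}.
Hypothesis markovQ : markov_measure Q.
Variable t : unit_itv R.

Let past := time_itv 0 (\val t).
Let future := time_itv (\val t) 1.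

Lemma present_in_past : [set t] `<=` past.
Proof.
move=> _ ->; rewrite /past /time_itv/= lexx andbT.
by have := set_valP t; rewrite /unit_itv/= in_itv/= => /andP[].
Qed.

(** Against a future event, a past function may be replaced by its conditional
    expectation given the present.  Only the indicator of [B] has to be
    conditioned on the past, which is exactly the case covered by the
    definition of a Markov measure. *)
Lemma integral_past_future (alpha Ea c : Omega R X k -> \bar R) (B : set (Omega R X k)) :
  measurable_at past alpha -> (forall w, 0 <= alpha w) ->
  cond_exp Q [set t] alpha Ea ->
  measurable_at [set t] c -> (forall w, 0 <= c w) ->
  <<s coord_events future >> B ->
  \int[Q]_w ((\1_B w)%:E * (c w * alpha w)) =
  \int[Q]_w ((\1_B w)%:E * (c w * Ea w)).
Proof.
move=> ma a0 aE mc c0 mB.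
have [mEa Ea0 _] := aE.
have [g [h [gE hE gh]]] := markovQ.2 t B mB.
have [mg g0 _] := gE; have [mh h0 _] := hE.
have mcp := sub_measurable_at present_in_past mc.
transitivity (\int[Q]_w ((c w * alpha w) * g w)).
  under eq_integral do rewrite muleC.
  apply: (cond_expE gE); first exact: measurable_atM.
  by move=> w; rewrite mule_ge0.
transitivity (\int[Q]_w ((c w * h w) * alpha w)).
  under [RHS]eq_integral do rewrite muleAC.
  apply: ae_eq_integral => //.
  - apply: (@measurable_at_fun _ _ _ past).
    by apply: measurable_atM => //; exact: measurable_atM.
  - apply: (@measurable_at_fun _ _ _ past).
    apply: measurable_atM; first exact: measurable_atM.
    exact: (sub_measurable_at present_in_past mh).
  - by apply: filterS gh => w -> .
rewrite (cond_expE aE); [|exact: measurable_atM|by move=> w; rewrite mule_ge0].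
under [LHS]eq_integral do rewrite muleAC.
rewrite -(cond_expE hE); [|exact: measurable_atM|by move=> w; rewrite mule_ge0].
by apply: eq_integral => w _; rewrite muleC.
Qed.

(** With [beta] in place of the indicator, the past-future identity tests
    [alpha beta] against every function [c] of the present, and such tests
    determine its conditional expectation. *)
Theorem cond_expM (alpha beta : Omega R X k -> R)
    (Ea Eb Eab : Omega R X k -> \bar R) :
  (forall w, 0 <= alpha w)%R -> (forall w, 0 <= beta w)%R ->
  measurable_at past alpha -> measurable_at future beta ->
  cond_exp Q [set t] (fun w => (alpha w)%:E) Ea ->
  cond_exp Q [set t] (fun w => (beta w)%:E) Eb ->
  cond_exp Q [set t] (fun w => (alpha w * beta w)%:E) Eab ->
  {ae Q, forall w, Eab w = Ea w * Eb w}.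
Proof.
move=> a0 b0 ma mb aE bE abE.
have [mEa Ea0 _] := aE; have [mEb Eb0 _] := bE; have [mEab Eab0 _] := abE.
have mea : measurable_at past (fun w => (alpha w)%:E).
  by rewrite /measurable_at; apply/measurable_EFinP.
have meb : measurable_at future (fun w => (beta w)%:E).
  by rewrite /measurable_at; apply/measurable_EFinP.
have mEaEb := measurable_atM mEa mEb.
apply: (ae_eq_measurable_at markovQ.1 mEab Eab0 mEaEb) => [w|c mc c0].
  by rewrite mule_ge0.
rewrite -(cond_expE abE)//.
transitivity (\int[Q]_w ((beta w)%:E * (c w * (alpha w)%:E))).
  by apply: eq_integral => w _; rewrite EFinM muleA muleC.
transitivity (\int[Q]_w ((beta w)%:E * (c w * Ea w))).
  apply: (eq_integral_pullback (@measurable_idfun_at R X k future)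
    (b := fun w => (beta w)%:E)) => //.
  - apply: (@measurable_at_fun _ _ _ past); apply: measurable_atM => //.
    exact: (sub_measurable_at present_in_past mc).
  - by move=> w; rewrite mule_ge0// lee_fin.
  - apply: (@measurable_at_fun _ _ _ [set t]); exact: measurable_atM.
  - by move=> w; rewrite mule_ge0.
  - move=> B mB; exact: integral_past_future.
under eq_integral do rewrite muleC.
rewrite (cond_expE bE); [|exact: measurable_atM|by move=> w; rewrite mule_ge0].
by apply: eq_integral => w _; rewrite muleA.
Qed.

End markov.

(** * Conditional expectation of a density *)

Section densities.
Context (R : realType) (X : ptopologicalType) (k : path_kind).
Variables (P Q : {measure set Omega R X k -> \bar R}).
Variable theta : Omega R X k -> R.
Hypothesis PQ : is_density P Q theta.

Lemma density_measure (A : set (Omega R X k)) : measurable A ->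
  P A = \int[Q]_w ((\1_A w)%:E * (theta w)%:E).
Proof.
move=> mA; have [_ _ <-] := PQ; first by rewrite integral_indic// setIT.
  by apply/measurable_EFinP; exact: measurable_indic.
by move=> w; rewrite lee_fin.
Qed.

Lemma density_ae (S : Omega R X k -> Prop) :
  {ae Q, forall w, S w} -> {ae P, forall w, S w}.
Proof.
move=> [N [mN N0 subN]]; exists N; split => //.
rewrite density_measure// -integral_indicE.
have [mt t0 _] := PQ.
under eq_integral do rewrite -[theta _]ger0_norm//.
apply: (integral_abs_eq0 (f := EFin \o theta)) => //.
by apply: measurable_funTS; apply/measurable_EFinP.
Qed.

Variables (t : unit_itv R) (E : Omega R X k -> \bar R).
Hypothesis thetaE : cond_exp Q [set t] (fun w => (theta w)%:E) E.

Lemma density_indic_condE (A : set (Omega R X k)) :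
  <<s coord_events [set t] >> A -> P A = \int[Q]_(w in A) E w.
Proof.
move=> mA; rewrite density_measure; last exact: measurable_at_set mA.
by rewrite [RHS]integral_indicE; exact: cond_exp_indic thetaE mA.
Qed.

Lemma density_condE_gt0 : {ae P, forall w, 0 < E w}.
Proof.
have [mE E0 _] := thetaE.
have mZ : <<s coord_events [set t] >> [set w | E w = 0].
  have := mE measurableT [set 0] (emeasurable_set1 _).
  by rewrite setTI.
exists [set w | E w = 0]; split.
- exact: measurable_at_set mZ.
- rewrite density_indic_condE//.
  by rewrite (eq_integral (cst 0)) ?integral0// => w; rewrite inE.
- by move=> w /= /negP; rewrite lt0e E0 andbT negbK => /eqP.
Qed.

(** The events that cover [Omega] come from the sigma-finiteness of the
    marginal of [P], not of [Q]: on each of them the integral of [E] is its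
    finite [P]-measure. *)
Lemma density_condE_lty : conditionable P -> {ae Q, forall w, E w < +oo}.
Proof.
move=> /(conditionable_cover t)[C [mC Coo CT]].
have [mE E0 _] := thetaE.
have mC' n : measurable (C n) := measurable_at_set (mC n).
have Ei n : Q.-integrable (C n) E.
  apply/integrableP; split.
    by apply: measurable_funTS; exact: measurable_at_fun mE.
  under eq_integral do rewrite gee0_abs//.
  by rewrite -density_indic_condE.
have := ae_foralln (fun n => integrable_ae (mC' n) (Ei n)).
apply: filterS => w Ew; have [n _ Cw] : (\bigcup_n C n) w by rewrite CT.
by rewrite -ge0_fin_numE//; exact: Ew Cw.
Qed.

End densities.

(** * Factorization of conditional expectations under a Markov measure *)

Theorem lemma3p1 (R : realType) (X : ptopologicalType) (polishX : polish R X)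
    (k : path_kind) (Q : {measure set (Omega R X k) -> \bar R})
    (markovQ : markov_measure Q) :
  (forall (t : unit_itv R) (alpha beta : Omega R X k -> R),
    (forall w, 0 <= alpha w)%R -> (forall w, 0 <= beta w)%R ->
    measurable_at (time_itv 0 (\val t)) alpha ->
    measurable_at (time_itv (\val t) 1) beta ->
    forall Ea Eb Eab : Omega R X k -> \bar R,
    cond_exp Q [set t] (fun w => (alpha w)%:E) Ea ->
    cond_exp Q [set t] (fun w => (beta w)%:E) Eb ->
    cond_exp Q [set t] (fun w => (alpha w * beta w)%:E) Eab ->
    {ae Q, forall w,
      (Eab w = 0 -> Ea w = 0 \/ Eb w = 0) /\
      (0 < Eab w ->
        [/\ 0 < Ea w, 0 < Eb w, Eab w = Ea w * Eb w & 0 < Eab w <= +oo])})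
  /\
  (forall (P : {measure set (Omega R X k) -> \bar R}) (t : unit_itv R)
      (alpha beta : Omega R X k -> R),
    conditionable P ->
    (forall w, 0 <= alpha w)%R -> (forall w, 0 <= beta w)%R ->
    measurable_at (time_itv 0 (\val t)) alpha ->
    measurable_at (time_itv (\val t) 1) beta ->
    is_density P Q (fun w => alpha w * beta w)%R ->
    forall Ea Eb Eab : Omega R X k -> \bar R,
    cond_exp Q [set t] (fun w => (alpha w)%:E) Ea ->
    cond_exp Q [set t] (fun w => (beta w)%:E) Eb ->
    cond_exp Q [set t] (fun w => (alpha w * beta w)%:E) Eab ->
    {ae P, forall w,
      [/\ 0 < Ea w < +oo, 0 < Eb w < +oo,
          Eab w = Ea w * Eb w & 0 < Eab w < +oo]} /\
    {ae Q, forall w,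
      Eab w =
        (\1_[set v | (Ea v < +oo)%E /\ (Eb v < +oo)%E] w)%:E * (Ea w * Eb w) /\
      0 <= Eab w < +oo}).
Proof.
have gt0_mul (x y : \bar R) : 0 <= x -> 0 <= y -> 0 < x * y -> 0 < x /\ 0 < y.
  move=> x0 y0; rewrite lt0e mule_eq0 negb_or => /andP[/andP[x0' y0'] _].
  by rewrite !lt0e x0 y0 x0' y0'.
have lty_mul (x y : \bar R) : 0 < x -> 0 < y -> x * y < +oo -> x < +oo /\ y < +oo.
  move=> x0 y0 xy; rewrite !ltey; split; apply/eqP => oo; move: xy.
    by rewrite oo gt0_mulye// ltxx.
  by rewrite oo gt0_muley// ltxx.
split=> [t alpha beta a0 b0 ma mb Ea Eb Eab aE bE abE|
         P t alpha beta condP a0 b0 ma mb PQ Ea Eb Eab aE bE abE].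
  have [_ Ea0 _] := aE; have [_ Eb0 _] := bE.
  apply: filterS (cond_expM markovQ a0 b0 ma mb aE bE abE) => w ->.
  split=> [/eqP|ab0]; first by rewrite mule_eq0 => /orP[]/eqP; [left|right].
  by have [] := gt0_mul _ _ (Ea0 w) (Eb0 w) ab0; split => //; rewrite ab0 leey.
have [_ Ea0 _] := aE; have [_ Eb0 _] := bE; have [_ Eab0 _] := abE.
have EM := cond_expM markovQ a0 b0 ma mb aE bE abE.
have Eoo := density_condE_lty PQ abE condP.
split.
  apply: filterS3 (density_ae PQ EM) (density_ae PQ Eoo) (density_condE_gt0 PQ abE).
  move=> w -> aboo ab0; have [Ea_gt0 Eb_gt0] := gt0_mul _ _ (Ea0 w) (Eb0 w) ab0.
  have [Ea_oo Eb_oo] := lty_mul _ _ Ea_gt0 Eb_gt0 aboo.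
  by split => //; apply/andP.
apply: filterS2 EM Eoo => w EM Eoo; split; last by rewrite Eab0.
rewrite EM indicE.
have [_|] := boolP (w \in [set v | Ea v < +oo /\ Eb v < +oo]).
  by rewrite mul1e.
rewrite notin_setE => h; rewrite mul0e.
apply/eqP; rewrite eq_le mule_ge0// andbT leNgt; apply/negP => ab0.
have [Ea_gt0 Eb_gt0] := gt0_mul _ _ (Ea0 w) (Eb0 w) ab0.
by apply: h; apply: lty_mul => //; rewrite -EM.
Qed.
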